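(* Let $\mathcal{K}$ be a mean whose domain contains bounded sets only, and let $\hat{\mathcal{K}}$ be its extension. If $\mathcal{K}$ is monotone and symmetric, then $\hat{\mathcal{K}}$ is symmetric.
   Context: A (generalized) mean is a function $\mathcal{K}: Dom(\mathcal{K})\to\bar{\mathbb{R}}=\mathbb{R}\cup\{-\infty,+\infty\}$, where $Dom(\mathcal{K})$ is a collection of nonempty subsets of $\mathbb{R}$, with $\inf H\le\mathcal{K}(H)\le\sup H$ for all $H\in Dom(\mathcal{K})$ (so values on bounded sets are real). Standing assumption on the domain of the original mean $\mathcal{K}$: it is closed under finite unions and nonempty finite intersections, and if $H\in Dom(\mathcal{K})$ and $I$ is a (finite or infinite) interval with $H\cap I\neq\emptyset$ then $H\cap I\in Dom(\mathcal{K})$. Extension: let $\mathcal{K}$ be a mean whose domain contains bounded sets only. Let $\emptyset\neq H\subset\mathbb{R}$ be such that $H\cap[x,y]\in Dom(\mathcal{K})$ for all real $x\le y$ with $H\cap[x,y]\neq\emptyset$. Set $\hat{\mathcal{K}}(H)=\lim_{x\to-\infty,\,y\to+\infty}\mathcal{K}(H\cap[x,y])$ if this double limit (with $x,y$ tending independently) exists in $\bar{\mathbb{R}}$; $Dom(\hat{\mathcal{K}})$ consists of all such $H$ for which the limit exists. A mean $\mathcal{M}$ is monotone if for all $H_1,H_2$ with $H_1,H_2,H_1\cup H_2\in Dom(\mathcal{M})$, $\sup H_1\le\inf H_2$ implies $\mathcal{M}(H_1)\le\mathcal{M}(H_1\cup H_2)\le\mathcal{M}(H_2)$. For $s\in\mathbb{R}$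 let $T_s(x)=2s-x$ be the reflection about $s$. A mean $\mathcal{M}$ is symmetric if whenever $H\in Dom(\mathcal{M})$, $s\in\mathbb{R}$ and $T_s(H)=H$, then $\mathcal{M}(H)=s$. *)

(* Defs.v *)
From HB Require Import structures.
From mathcomp Require Import all_boot all_order all_algebra.
From mathcomp Require Import all_classical all_reals all_analysis.
Set Implicit Arguments.
Unset Strict Implicit.
Unset Printing Implicit Defensive.
Import Order.TTheory GRing.Theory Num.Theory.
Import numFieldNormedType.Exports.
Local Open Scope classical_set_scope.
Local Open Scope ring_scope.

Definition sup_set (R : realType) (H : set R) : \bar R := ereal_sup (EFin @` H).
Definition inf_set (R : realType) (H : set R) : \bar R := ereal_inf (EFin @` H).

(* The partial function K is encoded by its domain and a total function whose
   values outside the domain are irrelevant. *)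
Record mean (R : realType) := Mean {
  mean_dom : set (set R);
  mean_val :> set R -> \bar R;
  mean_dom_neq0 : forall H, mean_dom H -> H !=set0;
  mean_bounds : forall H, mean_dom H ->
    (inf_set H <= mean_val H)%E /\ (mean_val H <= sup_set H)%E
}.

Definition dom_closed (R : realType) (K : mean R) : Prop :=
  [/\ forall H1 H2, mean_dom K H1 -> mean_dom K H2 -> mean_dom K (H1 `|` H2),
      forall H1 H2, mean_dom K H1 -> mean_dom K H2 -> H1 `&` H2 !=set0 ->
        mean_dom K (H1 `&` H2)
    & forall H I, mean_dom K H -> is_interval I -> H `&` I !=set0 ->
        mean_dom K (H `&` I)].

Definition mean_monotone (R : realType) (M : mean R) : Prop :=
  forall H1 H2, mean_dom M H1 -> mean_dom M H2 -> mean_dom M (H1 `|` H2) ->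
    (sup_set H1 <= inf_set H2)%E ->
    (M H1 <= M (H1 `|` H2))%E /\ (M (H1 `|` H2) <= M H2)%E.

Definition reflection (R : realType) (s x : R) : R := 2 * s - x.

Definition mean_symmetric (R : realType) (M : mean R) : Prop :=
  forall H s, mean_dom M H -> reflection s @` H = H -> M H = s%:E.

Section Extension.
Variables (R : realType) (K : mean R).

Definition truncated_mean (H : set R) (p : R * R) : \bar R :=
  K (H `&` `[p.1, p.2]).

(* x -> -oo and y -> +oo independently *)
Definition window_filter : set_system (R * R) :=
  filter_prod (ninfty_nbhs R) (pinfty_nbhs R).

#[local] Instance window_filter_proper : ProperFilter window_filter.
Proof. exact: filter_prod_proper. Qed.

Definition ext_dom : set (set R) := [set H |
  [/\ H !=set0,
      forall x y : R, x <= y -> H `&` `[x, y] !=set0 ->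
        mean_dom K (H `&` `[x, y])
    & exists l : \bar R, truncated_mean H @ window_filter --> l]].

Definition ext_val (H : set R) : \bar R :=
  lim (truncated_mean H @ window_filter).

Lemma ext_dom_neq0 H : ext_dom H -> H !=set0.
Proof. by case. Qed.

Lemma near_truncated_dom H : ext_dom H ->
  \forall p \near window_filter, mean_dom K (H `&` `[p.1, p.2]).
Proof.
move=> [[h Hh] Hdom _].
exists ([set x | x < h], [set y | h < y]).
  split; first exact: nbhs_ninfty_lt (num_real h).
  exact: nbhs_pinfty_gt (num_real h).
move=> [x y] /= [xh hy]; apply: Hdom; first exact/ltW/(lt_trans xh).
by exists h; split=> //=; rewrite in_itv /= (ltW xh) (ltW hy).
Qed.

Lemma ext_bounds H : ext_dom H ->
  (inf_set H <= ext_val H)%E /\ (ext_val H <= sup_set H)%E.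
Proof.
move=> HD; have nD := near_truncated_dom HD; case: HD => _ _ [l cl].
have -> : ext_val H = l by exact: cvg_lim.
have sub p : EFin @` (H `&` `[p.1, p.2]) `<=` EFin @` H.
  by apply: image_subset => x [].
split.
- apply: (closed_cvg (fun x => (inf_set H <= x)%E) _ _ _ cl).
    exact: closed_ereal_le_ereal.
  apply: filterS nD => p /mean_bounds[+ _]; apply: le_trans.
  exact: ereal_inf_le_tmp.
- apply: (closed_cvg (fun x => (x <= sup_set H)%E) _ _ _ cl).
    exact: closed_ereal_ge_ereal.
  apply: filterS nD => p /mean_bounds[_ Kp]; apply: (le_trans Kp).
  exact: ereal_sup_le.
Qed.

Definition extension : mean R := Mean ext_dom_neq0 ext_bounds.

End Extension.

(* Main.v *)
Require Import Defs.
From mathcomp Require Import all_boot all_order all_algebra.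
From mathcomp Require Import all_classical all_reals all_analysis.
From mathcomp Require Import ring lra.
Import Order.TTheory GRing.Theory Num.Theory.
Import numFieldNormedType.Exports.
Local Open Scope classical_set_scope.
Local Open Scope ring_scope.

(** If [H] is invariant under the reflection about [s], then so is its trace on
    every window [[s - a, s + a]] centred at [s], and the symmetry of [K] gives
    each nonempty such trace the mean [s] exactly.  The double limit defining the
    extension exists by definition of its domain, so it may be computed along
    any family of windows that exhausts the line; along the centred windows it
    is the limit of a function eventually equal to [s]. *)

(** The independent double limit specializes to a limit in the single radius
    [a], because the two endpoints leave every bounded set simultaneously. *)
Lemma cvg_centered_window (R : realType) (s : R) :
  (fun a : R => (s - a, s + a)) @ +oo%R --> @window_filter R.
Proof.
move=> A [[B C] /= [[M [_ BM]] [N [_ CN]]] BCA].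
exists (Num.max (s - M) (N - s)); split; first exact: num_real.
move=> a; rewrite gt_max => /andP[Ma Na].
by apply: BCA; split; [apply: BM|apply: CN] => /=; lra.
Qed.

Lemma reflection_centered_window (R : realType) (s a : R) (H : set R) :
  reflection s @` H = H ->
  reflection s @` (H `&` `[s - a, s + a]) = H `&` `[s - a, s + a].
Proof.
move=> sH.
have reflH x : H x -> H (reflection s x).
  by move=> Hx; rewrite -sH; exists x.
have reflI x : x \in `[s - a, s + a] -> reflection s x \in `[s - a, s + a].
  by rewrite !in_itv /= /reflection => /andP[? ?]; apply/andP; split; lra.
apply/seteqP; split=> [_ [x [Hx Ix] <-]|x [Hx Ix]].
  by split; [exact: reflH|exact: reflI].
exists (reflection s x); first by split; [exact: reflH|exact: reflI].
by rewrite /reflection; ring.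
Qed.

Theorem proposition4p13 (R : realType) (K : mean R)
    (K_closed : dom_closed K)
    (K_bounded : forall H : set R, mean_dom K H -> bounded_set H)
    (K_monotone : mean_monotone K)
    (K_symmetric : mean_symmetric K) :
  mean_symmetric (extension K).
Proof.
move=> H s HD sH.
have inD : \forall a \near +oo%R, mean_dom K (H `&` `[s - a, s + a]).
  exact: (@cvg_centered_window R s _ (near_truncated_dom HD)).
case: HD => _ _ [l cl].
have PF : ProperFilter (@window_filter R) by exact: filter_prod_proper.
have -> : extension K H = l by exact: cvg_lim.
have cw : truncated_mean K H (s - a, s + a) @[a --> +oo%R] --> l.
  exact: cvg_comp (@cvg_centered_window R s) cl.
have cs : truncated_mean K H (s - a, s + a) @[a --> +oo%R] --> s%:E.
  apply: cvg_near_cst; apply: filterS inD => a Da.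
  by apply: K_symmetric => //; exact: reflection_centered_window.
exact: (cvg_unique _ cw cs).
Qed.
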